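(* For every real $\xi>0$ and every $\theta\in[0,\pi/5]$, with $u=e^{i\theta}$, the number $$y_1=\sqrt[5]{2\xi+\frac{2u^2}{5}t_0^3+\frac{2u^3}{25}t_0^2+\frac{u^4}{125}t_0+\frac{u^5}{3125}}-\frac{u}{5},\qquad t_0=\sqrt[4]{\frac{2\xi}{u+(\xi/\alpha)^{2/9}}},\qquad \alpha=\sqrt{\frac{2+\sqrt2}{4}},$$ satisfies $$|y_1-y^*|<4.32\times 10^{-3},$$ where $y^*$ is the distinguished root of $\frac{y^5+uy^4}{2}=\xi$ defined in the context.
   Context: Convention: the $n$-th root of a complex number is the one whose argument lies in $[-\pi/n,\pi/n[$; $(\xi/\alpha)^{2/9}$ is a positive real number. Distinguished root $y^*$: for $\xi>0$, $\theta\in\,]0,\pi/5]$ and $u=e^{i\theta}$, the equation $\frac{y^5+uy^4}{2}=\xi$ has exactly one root of the form $re^{i\sigma}$ with $r>0$ and $\sigma\in[-\theta/4,0[$; this root is called $y^*$. For $\theta=0$ (so $u=1$), $y^*$ is the unique positive real root of the equation. *)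

(* Defs.v *)
From Stdlib Require Import Reals Lra Lia ClassicalEpsilon.
From Coquelicot Require Import Coquelicot.
Open Scope R_scope.

(* e^{i t} *)
Definition cis (t : R) : C := (cos t, sin t).

(* The argument convention is [-PI/n, PI/n[; w = 0 is covered by r = 0. *)
Definition is_nth_root (n : nat) (z w : C) : Prop :=
  (w ^ n)%C = z /\
  exists r sigma : R,
    0 <= r /\ - (PI / INR n) <= sigma < PI / INR n /\
    w = (RtoC r * cis sigma)%C.

(* Meaningful for n > 0 only: see nth_root_spec and is_nth_root_unique. *)
Definition nth_root (n : nat) (z : C) : C :=
  epsilon (inhabits (RtoC 0)) (is_nth_root n z).

Definition is_distinguished_root (xi theta : R) (y : C) : Prop :=
  ((y ^ 5 + cis theta * y ^ 4) / 2)%C = RtoC xi /\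
  (0 < theta ->
     exists r sigma : R,
       0 < r /\ - (theta / 4) <= sigma < 0 /\ y = (RtoC r * cis sigma)%C) /\
  (theta = 0 -> exists r : R, 0 < r /\ y = RtoC r).

Definition alpha : R := sqrt ((2 + sqrt 2) / 4).

Definition t0 (xi theta : R) : C :=
  nth_root 4
    (RtoC (2 * xi) / (cis theta + RtoC (Rpower (xi / alpha) (2 / 9))))%C.

Definition y1 (xi theta : R) : C :=
  let u := cis theta in
  let t := t0 xi theta in
  (nth_root 5
     (RtoC (2 * xi) + 2 * u ^ 2 / 5 * t ^ 3 + 2 * u ^ 3 / 25 * t ^ 2
      + u ^ 4 / 125 * t + u ^ 5 / 3125)
   - u / 5)%C.

Lemma cis_add (a b : R) : cis (a + b) = (cis a * cis b)%C.
Proof.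
  unfold cis, Cmult; simpl; rewrite cos_plus, sin_plus; f_equal; ring.
Qed.

Lemma cis_0 : cis 0 = RtoC 1.
Proof. unfold cis; now rewrite cos_0, sin_0. Qed.

Lemma cis_pow (t : R) (n : nat) : (cis t ^ n)%C = cis (INR n * t).
Proof.
  induction n as [|n IH].
  - simpl; rewrite Rmult_0_l; symmetry; apply cis_0.
  - rewrite Cpow_S, IH, S_INR, <- cis_add; f_equal; ring.
Qed.

Lemma Cmod_cis (t : R) : Cmod (cis t) = 1.
Proof.
  unfold Cmod, cis; simpl fst; simpl snd.
  replace (cos t ^ 2 + sin t ^ 2) with 1; [apply sqrt_1|].
  rewrite <- (sin2_cos2 t); unfold Rsqr; ring.
Qed.

Lemma Cmod_polar (r t : R) : 0 <= r -> Cmod (RtoC r * cis t) = r.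
Proof.
  intros Hr; rewrite Cmod_mult, Cmod_cis, Cmod_R, Rabs_pos_eq; lra.
Qed.

Lemma cis_inj (a b : R) : - (2 * PI) < a - b < 2 * PI -> cis a = cis b -> a = b.
Proof.
  intros Hd Heq; injection Heq as Hc Hs.
  assert (H1 : cos (a - b) = 1).
  { rewrite cos_minus, Hc, Hs, <- (sin2_cos2 b); unfold Rsqr; ring. }
  replace (a - b) with (2 * ((a - b) / 2)) in H1 by field.
  rewrite cos_2a_sin in H1.
  assert (H0 : sin ((a - b) / 2) = 0) by nra.
  destruct (Rtotal_order a b) as [H|[H|H]]; [|exact H|].
  - pose proof (sin_gt_0 (- ((a - b) / 2))) as H2.
    rewrite sin_neg in H2; lra.
  - pose proof (sin_gt_0 ((a - b) / 2)); lra.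
Qed.

Lemma polar_exists (z : C) :
  exists r t : R, 0 <= r /\ - PI <= t < PI /\ z = (RtoC r * cis t)%C.
Proof.
  pose proof PI_RGT_0 as Hpi.
  destruct (Ceq_dec z 0) as [->|Hz].
  - exists 0, 0; repeat split; try lra; now rewrite Cmult_0_l.
  - assert (Hm : 0 < Cmod z) by now apply Cmod_gt_0.
    destruct z as [x y]; set (m := Cmod (x, y)) in *.
    assert (Hsq : m * m = x * x + y * y).
    { unfold m, Cmod; simpl fst; simpl snd; rewrite sqrt_sqrt; [ring|nra]. }
    assert (Hc : -1 <= x / m <= 1).
    { split; [apply Rle_div_r | apply Rle_div_l]; try lra.
      - apply Rnot_lt_le; intro H; nra.
      - apply Rnot_lt_le; intro H; nra. }
    pose proof (acos_bound (x / m)) as Hb.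
    pose proof (cos_acos (x / m) Hc) as Hcos.
    pose proof (sin_ge_0 (acos (x / m)) (proj1 Hb) (proj2 Hb)) as Hs0.
    pose proof (sin2_cos2 (acos (x / m))) as H1.
    rewrite Hcos in H1; unfold Rsqr in H1.
    set (s := sin (acos (x / m))) in *.
    assert (Hx : m * (x / m) = x) by (field; lra).
    assert (Hs : (m * s - y) * (m * s + y) = 0).
    { transitivity (m * m * (s * s) - y * y); [ring|].
      replace (s * s) with (1 - x / m * (x / m)) by lra.
      transitivity (m * m - m * (x / m) * (m * (x / m)) - y * y); [ring|].
      rewrite Hx; lra. }
    assert (Hms : 0 <= m * s) by (apply Rmult_le_pos; lra).
    apply Rmult_integral in Hs.
    assert (Hpol : forall t, m * cos t = x -> m * sin t = y ->
                     (x, y) = (RtoC m * cis t)%C).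
    { intros t Ht Ht'; unfold Cmult, cis, RtoC; simpl.
      rewrite <- Ht, <- Ht'; f_equal; ring. }
    destruct (Rlt_dec y 0) as [Hy|Hy].
    + exists m, (- acos (x / m)).
      assert (acos (x / m) <> 0).
      { intro E; assert (s = 0) by (unfold s; rewrite E; apply sin_0).
        replace (m * s) with 0 in * by (rewrite H; ring); lra. }
      repeat split; try lra.
      apply Hpol; [rewrite cos_neg, Hcos; exact Hx|].
      rewrite sin_neg; fold s; lra.
    + destruct (Req_dec (acos (x / m)) PI) as [E|E].
      * assert (Hs1 : s = 0) by (unfold s; rewrite E; apply sin_PI).
        rewrite Hs1, Rmult_0_r in Hs.
        exists m, (- PI); repeat split; try lra; apply Hpol.
        -- rewrite cos_neg, <- E, Hcos; exact Hx.
        -- rewrite sin_neg, sin_PI, Ropp_0, Rmult_0_r; lra.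
      * exists m, (acos (x / m)); repeat split; try lra; apply Hpol.
        -- rewrite Hcos; exact Hx.
        -- fold s; lra.
Qed.

Lemma pow_root_exists (n : nat) (r : R) :
  (0 < n)%nat -> 0 <= r -> exists q : R, 0 <= q /\ q ^ n = r.
Proof.
  intros Hn [Hr|<-].
  - exists (Rpower r (/ INR n)); split; [left; apply exp_pos|].
    rewrite <- Rpower_pow by apply exp_pos.
    rewrite Rpower_mult, Rinv_l by (apply not_0_INR; lia).
    now apply Rpower_1.
  - exists 0; split; [lra|]; apply pow_i; lia.
Qed.

Lemma is_nth_root_exists (n : nat) (z : C) :
  (0 < n)%nat -> exists w : C, is_nth_root n z w.
Proof.
  intros Hn.
  assert (HN : 0 < INR n) by now apply lt_0_INR.
  destruct (polar_exists z) as (r & t & Hr & Ht & ->).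
  destruct (pow_root_exists n r Hn Hr) as (q & Hq & <-).
  exists (RtoC q * cis (t / INR n))%C; split.
  - rewrite Cpow_mult_l, cis_pow, RtoC_pow.
    replace (INR n * (t / INR n)) with t by (field; lra); reflexivity.
  - exists q, (t / INR n); repeat split; [exact Hq| |].
    + replace (- (PI / INR n)) with ((- PI) / INR n) by (field; lra).
      apply Rmult_le_compat_r; [left; now apply Rinv_0_lt_compat|lra].
    + apply Rmult_lt_compat_r; [now apply Rinv_0_lt_compat|lra].
Qed.

Lemma is_nth_root_unique (n : nat) (z w w' : C) :
  (0 < n)%nat -> is_nth_root n z w -> is_nth_root n z w' -> w = w'.
Proof.
  intros Hn (Hz & r & s & Hr & Hs & ->) (Hz' & r' & s' & Hr' & Hs' & ->).
  assert (HN : 0 < INR n) by now apply lt_0_INR.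
  rewrite <- Hz' in Hz; clear Hz'.
  assert (E : r = r').
  { pose proof (f_equal Cmod Hz) as HM.
    rewrite !Cmod_pow, !Cmod_polar in HM by assumption.
    destruct (Rtotal_order r r') as [H|[H|H]]; [|exact H|].
    - assert (r ^ n < r' ^ n); [|lra].
      destruct n as [|n]; [lia|]; clear -H Hr.
      induction n as [|n IH]; [simpl; lra|].
      change (r * r ^ S n < r' * r' ^ S n).
      pose proof (pow_le r (S n) Hr); nra.
    - assert (r' ^ n < r ^ n); [|lra].
      destruct n as [|n]; [lia|]; clear -H Hr'.
      induction n as [|n IH]; [simpl; lra|].
      change (r' * r' ^ S n < r * r ^ S n).
      pose proof (pow_le r' (S n) Hr'); nra. }
  subst r'.
  destruct (Req_dec r 0) as [->|Hr0]; [now rewrite !Cmult_0_l|].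
  rewrite !Cpow_mult_l, !cis_pow in Hz.
  assert (Hp : (RtoC r ^ n)%C <> 0)
    by (apply Cpow_nz; intro E; apply Hr0; now injection E).
  apply (f_equal (Cmult (/ (RtoC r ^ n)))) in Hz.
  rewrite !Cmult_assoc, Cinv_l, !Cmult_1_l in Hz by exact Hp.
  assert (HP : INR n * (PI / INR n) = PI) by (field; lra).
  apply cis_inj in Hz; [|nra].
  apply Rmult_eq_reg_l in Hz; [now subst|lra].
Qed.

Lemma nth_root_spec (n : nat) (z : C) :
  (0 < n)%nat -> is_nth_root n z (nth_root n z).
Proof.
  intros Hn; unfold nth_root; apply epsilon_spec.
  now apply is_nth_root_exists.
Qed.

Lemma is_distinguished_root_exists (xi theta : R) :
  0 < xi -> 0 <= theta <= PI / 5 ->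
  exists y : C, is_distinguished_root xi theta y.
Proof.
  intros Hxi [[Hth|<-] Hth5]; pose proof PI_RGT_0 as Hpi.
  - set (G := fun s : R =>
      2 * xi * sin (5 * s) ^ 5 - sin (theta - 4 * s) ^ 4 * sin (theta + s)).
    destruct (IVT G 0 (theta / 4)) as (s & [Hs0 Hs1] & HG).
    + unfold G; reg.
    + lra.
    + unfold G.
      replace (5 * 0) with 0 by ring; replace (theta - 4 * 0) with theta by ring.
      rewrite Rplus_0_r, sin_0.
      assert (0 < sin theta) by (apply sin_gt_0; lra).
      pose proof (pow_lt (sin theta) 5 H); simpl in *; lra.
    + unfold G.
      replace (theta - 4 * (theta / 4)) with 0 by field; rewrite sin_0.
      assert (0 < sin (5 * (theta / 4))) by (apply sin_gt_0; lra).
      pose proof (pow_lt _ 5 H).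
      pose proof (Rmult_lt_0_compat (2 * xi) _ ltac:(lra) H0).
      simpl in *; lra.
    + assert (Hs : 0 < s < theta / 4).
      { split; (apply Rnot_le_lt; intro H).
        - assert (s = 0) by lra; subst s; unfold G in HG.
          replace (5 * 0) with 0 in HG by ring.
          replace (theta - 4 * 0) with theta in HG by ring.
          rewrite Rplus_0_r, sin_0 in HG.
          assert (Hp : 0 < sin theta) by (apply sin_gt_0; lra).
          pose proof (pow_lt (sin theta) 5 Hp); simpl in *; lra.
        - assert (s = theta / 4) by lra; subst s; unfold G in HG.
          replace (theta - 4 * (theta / 4)) with 0 in HG by field.
          rewrite sin_0 in HG.
          assert (Hp : 0 < sin (5 * (theta / 4))) by (apply sin_gt_0; lra).
          pose proof (pow_lt _ 5 Hp) as Hp5.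
          pose proof (Rmult_lt_0_compat (2 * xi) _ ltac:(lra) Hp5).
          simpl in *; lra. }
      unfold G in HG.
      assert (H5 : 0 < sin (5 * s)) by (apply sin_gt_0; lra).
      assert (Ha : 0 < sin (theta - 4 * s)) by (apply sin_gt_0; lra).
      set (r := sin (theta - 4 * s) / sin (5 * s)).
      assert (Hr : 0 < r) by now apply Rdiv_lt_0_compat.
      assert (Hsum : (RtoC r * cis (- s) + cis theta)%C
                = (RtoC (sin (theta + s) / sin (5 * s)) * cis (4 * s))%C).
      { replace theta with ((theta - 4 * s) + 4 * s) at 1 by ring.
        replace (theta + s) with ((theta - 4 * s) + 5 * s) by ring.
        replace (- s) with (- (5 * s) + 4 * s) by ring.
        rewrite !cis_add, Cmult_assoc, <- Cmult_plus_distr_r; f_equal.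
        unfold r, cis, Cmult, Cplus, RtoC; simpl.
        rewrite cos_neg, sin_neg, sin_plus; f_equal; field; lra. }
      exists (RtoC r * cis (- s))%C; split; [|split].
      * transitivity ((RtoC r * cis (- s)) ^ 4
                        * (RtoC r * cis (- s) + cis theta) / 2)%C;
          [unfold Cdiv; ring|].
        rewrite Hsum, Cpow_mult_l, cis_pow.
        transitivity (RtoC r ^ 4 * RtoC (sin (theta + s) / sin (5 * s))
                        * (cis (INR 4 * - s) * cis (4 * s)) / 2)%C;
          [unfold Cdiv; ring|].
        rewrite <- cis_add.
        replace (INR 4 * - s + 4 * s) with 0 by (simpl; ring).
        rewrite cis_0, <- RtoC_pow, <- !RtoC_mult, <- RtoC_div by lra.
        f_equal; unfold r.
        apply (Rmult_eq_reg_l (2 * sin (5 * s) ^ 5));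
          [|apply Rgt_not_eq; pose proof (pow_lt _ 5 H5); lra].
        transitivity (sin (theta - 4 * s) ^ 4 * sin (theta + s));
          [field; lra|lra].
      * intros _; exists r, (- s); repeat split; lra.
      * lra.
  - set (G := fun s : R => s ^ 5 + s ^ 4 - 2 * xi).
    destruct (IVT G 0 (1 + 2 * xi)) as (s & [Hs0 Hs1] & HG).
    + unfold G; reg.
    + lra.
    + unfold G; simpl; lra.
    + unfold G.
      assert (1 <= (1 + 2 * xi) ^ 4) by (apply pow_R1_Rle; lra).
      change ((1 + 2 * xi) ^ 5) with ((1 + 2 * xi) * (1 + 2 * xi) ^ 4); nra.
    + unfold G in HG.
      assert (Hs : 0 < s).
      { apply Rnot_le_lt; intro H; assert (s = 0) by lra; subst s.
        simpl in HG; lra. }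
      exists (RtoC s); split; [|split].
      * rewrite cis_0, <- !RtoC_pow, <- RtoC_mult, <- RtoC_plus.
        rewrite <- RtoC_div by lra; f_equal; lra.
      * lra.
      * intros _; exists s; auto.
Qed.

(* Main.v *)
Require Import Defs.
From Stdlib Require Import Reals Lra Lia List.
From Coquelicot Require Import Coquelicot.
Import ListNotations.
Open Scope R_scope.

(** Write ystar = r e^{-is}, p = (xi/alpha)^{2/9} and rho = |u + ystar|, so that
    ystar^4 (u + ystar) = t0^4 (u + p) = 2 xi and 2 xi = r^4 rho. The constant
    alpha is the one for which p >= r always holds, with p close to r for moderate
    r. Completing the fifth power, w = ystar + u/5 is a fifth root of Q(ystar) for
    a cubic Q, and y1 + u/5 is the fifth root of Q(t0); both have their arguments
    in [-PI/20, PI/5]. Hence y1 - ystar is controlled in two steps: h = t0/ystar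
    satisfies h^4 = (u + ystar)/(u + p), and g = (y1 + u/5)/w satisfies
    g^5 - 1 = (Q(t0) - Q(ystar))/w^5; both h - 1 and g - 1 are estimated by
    dividing by a geometric sum. All bounds depend on r only, uniformly in theta.
    The polynomial inequalities in r that remain are settled by Bernstein
    coefficients for r <= 60, and by the crude bound |h - 1| <= 1 beyond. *)

(** * Elementary bounds: [PI], the cosine, moduli of polar sums *)

(** Otherwise [7875/10000 = 3.15/4] would be at most [PI/4], yet the Taylor upper bound
    [1 - x^2/2 + x^4/24] there is already below [cos (PI/4)], the positive root of [2 c^2 = 1]. *)
Lemma PI_lt_315 : PI < 315 / 100.
Proof.
  apply Rnot_le_lt; intro H; pose proof PI_4.
  set (x := 7875 / 10000).
  pose proof (pre_cos_bound x 0 ltac:(unfold x; lra) ltac:(unfold x; lra)) as [_ Hb].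
  unfold cos_approx, cos_term in Hb; simpl in Hb.
  assert (Hd : cos (PI / 4) <= cos x) by (apply cos_decr_1; unfold x; lra).
  assert (Hp : 0 < cos (PI / 4)) by (apply cos_gt_0; lra).
  assert (E : 2 * cos (PI / 4) * cos (PI / 4) = 1).
  { pose proof (cos_2a_cos (PI / 4)) as E.
    replace (2 * (PI / 4)) with (PI / 2) in E by field; rewrite cos_PI2 in E; lra. }
  assert (cos x <= 706 / 1000) by (unfold x in *; lra).
  nra.
Qed.

Lemma cos_ge_quadratic (t : R) : 1 - t ^ 2 / 2 <= cos t.
Proof.
  replace t with (2 * (t / 2)) at 2 by field.
  rewrite cos_2a_sin.
  assert (Hpos : forall x, 0 <= x -> sin x ^ 2 <= x ^ 2).
  { intros x Hx; apply pow_maj_Rabs; apply Rabs_le.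
    destruct Hx as [Hx| <-]; [|rewrite sin_0; lra].
    split; [|left; now apply sin_lt_x].
    destruct (Rle_lt_dec x 1) as [H1|H1]; [|pose proof (SIN_bound x); lra].
    pose proof PI2_1; pose proof (sin_ge_0 x); lra. }
  assert (H : sin (t / 2) ^ 2 <= (t / 2) ^ 2).
  { destruct (Rle_lt_dec 0 (t / 2)) as [H|H]; [now apply Hpos|].
    pose proof (Hpos (- (t / 2)) ltac:(lra)) as H'.
    rewrite sin_neg in H'; nra. }
  nra.
Qed.

Lemma Cmod_sqr (z : C) : Cmod z ^ 2 = fst z ^ 2 + snd z ^ 2.
Proof.
  unfold Cmod; rewrite pow2_sqrt; [reflexivity|]; nra.
Qed.

Lemma Cmod_polar_add_sqr (a b s t : R) :
  Cmod (RtoC a * cis s + RtoC b * cis t)%C ^ 2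
    = a ^ 2 + 2 * a * b * cos (s - t) + b ^ 2.
Proof.
  rewrite Cmod_sqr, cos_minus; unfold cis; simpl.
  pose proof (sin2_cos2 s) as H1; pose proof (sin2_cos2 t) as H2; unfold Rsqr in *.
  apply (f_equal (Rmult (a * a))) in H1; apply (f_equal (Rmult (b * b))) in H2; lra.
Qed.

Lemma fst_le_Cmod (z : C) : fst z <= Cmod z.
Proof.
  pose proof (Cmod_ge_0 z); pose proof (Cmod_sqr z); nra.
Qed.

(** * Lower bounds for geometric sums and stability of fifth roots *)

(** This is the cofactor of [h - 1] in [h^4 - 1]. The weights [971/1000] and [996/1000] lie below
    [cos (3 PI/40)] and [cos (PI/40)]. *)
Lemma geom4_polar_lower (x phi : R) :
  0 <= x -> Rabs phi <= PI / 20 ->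
  971 / 1000 * (1 + x ^ 3) + 996 / 1000 * (x + x ^ 2)
    <= Cmod (1 + RtoC x * cis phi + (RtoC x * cis phi) ^ 2
             + (RtoC x * cis phi) ^ 3)%C.
Proof.
  intros Hx Hphi.
  (* Factoring out the middle phase makes the remaining sum nearly real. *)
  set (K := (RtoC 1 * cis (- (3 / 2 * phi)) + RtoC x * cis (- (1 / 2 * phi))
             + RtoC (x ^ 2) * cis (1 / 2 * phi) + RtoC (x ^ 3) * cis (3 / 2 * phi))%C).
  replace (1 + RtoC x * cis phi + (RtoC x * cis phi) ^ 2 + (RtoC x * cis phi) ^ 3)%C
    with (cis (3 / 2 * phi) * K)%C.
  2:{ unfold K; rewrite !Cpow_mult_l, !cis_pow, !RtoC_pow.
      rewrite !Cmult_plus_distr_l, !Cmult_assoc, !(Cmult_comm (cis (3 / 2 * phi))).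
      rewrite <- !Cmult_assoc, <- !cis_add.
      replace (3 / 2 * phi + - (3 / 2 * phi)) with 0 by ring.
      replace (3 / 2 * phi + - (1 / 2 * phi)) with phi by field.
      replace (3 / 2 * phi + 1 / 2 * phi) with (INR 2 * phi) by (simpl; field).
      replace (3 / 2 * phi + 3 / 2 * phi) with (INR 3 * phi) by (simpl; field).
      rewrite cis_0; ring. }
  rewrite Cmod_mult, Cmod_cis, Rmult_1_l.
  refine (Rle_trans _ _ _ _ (fst_le_Cmod K)).
  unfold K, cis; simpl; rewrite !cos_neg.
  pose proof PI_lt_315; apply Rabs_le_between in Hphi.
  (* From [(3.15 / 20)^2 = 0.02480625]. *)
  assert (phi ^ 2 <= 249 / 10000) by nra.
  pose proof (cos_ge_quadratic (3 / 2 * phi)); pose proof (cos_ge_quadratic (1 / 2 * phi)).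
  assert (Hc3 : 9719 / 10000 <= cos (3 / 2 * phi)) by nra.
  assert (Hc1 : 9968 / 10000 <= cos (1 / 2 * phi)) by nra.
  pose proof (pow_le x 2 Hx); pose proof (pow_le x 3 Hx); simpl in *.
  nra.
Qed.

(** With the middle phase factored out, the outer terms carry [cos (2 phi) >= 0] and are dropped.
    The inner ones carry [cos phi], at least [7/10] because [2 cos^2 phi - 1 >= 0]. *)
Lemma geom5_polar_lower (x phi : R) :
  0 <= x -> Rabs phi <= PI / 4 ->
  x ^ 2 + 7 / 10 * (x + x ^ 3)
    <= Cmod (1 + RtoC x * cis phi + (RtoC x * cis phi) ^ 2
             + (RtoC x * cis phi) ^ 3 + (RtoC x * cis phi) ^ 4)%C.
Proof.
  intros Hx Hphi.
  set (K := (RtoC 1 * cis (- (2 * phi)) + RtoC x * cis (- phi) + RtoC (x ^ 2) * cis 0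
             + RtoC (x ^ 3) * cis phi + RtoC (x ^ 4) * cis (2 * phi))%C).
  replace (1 + RtoC x * cis phi + (RtoC x * cis phi) ^ 2 + (RtoC x * cis phi) ^ 3
           + (RtoC x * cis phi) ^ 4)%C
    with (cis (2 * phi) * K)%C.
  2:{ unfold K; rewrite !Cpow_mult_l, !cis_pow, !RtoC_pow.
      rewrite !Cmult_plus_distr_l, !Cmult_assoc, !(Cmult_comm (cis (2 * phi))).
      rewrite <- !Cmult_assoc, <- !cis_add.
      replace (2 * phi + - (2 * phi)) with 0 by ring.
      replace (2 * phi + - phi) with phi by ring.
      replace (2 * phi + 0) with (INR 2 * phi) by (simpl; ring).
      replace (2 * phi + phi) with (INR 3 * phi) by (simpl; ring).
      replace (2 * phi + 2 * phi) with (INR 4 * phi) by (simpl; ring).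
      rewrite cis_0; ring. }
  rewrite Cmod_mult, Cmod_cis, Rmult_1_l.
  refine (Rle_trans _ _ _ _ (fst_le_Cmod K)).
  unfold K, cis; simpl; rewrite !cos_neg, cos_0.
  apply Rabs_le_between in Hphi; pose proof PI_RGT_0.
  assert (Hc2 : 0 <= cos (2 * phi)) by (apply cos_ge_0; lra).
  assert (Hc0 : 0 <= cos phi) by (apply cos_ge_0; lra).
  assert (Hc1 : 7 / 10 <= cos phi) by (rewrite cos_2a_cos in Hc2; nra).
  pose proof (pow_le x 3 Hx); pose proof (pow_le x 4 Hx); simpl in *.
  nra.
Qed.

(** A bootstrap on [g^5 - 1 = (g - 1) S]. The smallness hypothesis keeps [x] above [97/100]; the
    crude bound on [S] then forces [g] close to 1, where [S] is nearly 5, whence the factor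
    [486/100]. *)
Lemma root5_stable (x phi : R) :
  0 <= x -> Rabs phi <= PI / 4 ->
  Cmod ((RtoC x * cis phi) ^ 5 - 1)%C <= 3 / 100 ->
  486 / 100 * Cmod (RtoC x * cis phi - 1)%C <= Cmod ((RtoC x * cis phi) ^ 5 - 1)%C.
Proof.
  intros Hx Hphi.
  pose proof (geom5_polar_lower x phi Hx Hphi) as Hlow.
  assert (Hg : Cmod (RtoC x * cis phi)%C = x) by now apply Cmod_polar.
  set (g := (RtoC x * cis phi)%C) in *.
  set (S := (1 + g + g ^ 2 + g ^ 3 + g ^ 4)%C) in *.
  replace (g ^ 5 - 1)%C with ((g - 1) * S)%C by (unfold S; ring).
  intros Heta; rewrite Cmod_mult in *.
  pose proof (Cmod_ge_0 (g - 1)%C) as Hd0; pose proof (Cmod_ge_0 S) as HS0.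
  assert (Hx1 : 97 / 100 <= x).
  { apply Rnot_lt_le; intro Hlt.
    assert (H5 : x ^ 5 <= (97 / 100) ^ 5) by (apply pow_incr; lra).
    assert (Ht : Cmod 1 <= Cmod (g ^ 5) + Cmod (1 - g ^ 5)%C).
    { replace (RtoC 1) with (g ^ 5 + (1 - g ^ 5))%C at 1 by ring; apply Cmod_triangle. }
    rewrite Cmod_1, Cmod_pow, Hg in Ht.
    replace (1 - g ^ 5)%C with (- ((g - 1) * S))%C in Ht by (unfold S; ring).
    rewrite Cmod_opp, Cmod_mult in Ht; lra. }
  assert (HS : 225 / 100 <= Cmod S).
  { assert ((97 / 100) ^ 2 <= x ^ 2) by (apply pow_incr; lra).
    assert ((97 / 100) ^ 3 <= x ^ 3) by (apply pow_incr; lra). lra. }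
  assert (Hd : Cmod (g - 1)%C <= 134 / 10000) by nra.
  assert (Hx2 : x <= 10134 / 10000).
  { rewrite <- Hg; replace g with (1 + (g - 1))%C at 1 by ring.
    eapply Rle_trans; [apply Cmod_triangle|]; rewrite Cmod_1; lra. }
  (* S - 5 = (g - 1) T, so a small g - 1 brings S close to 5. *)
  set (T := (4 + 3 * g + 2 * g ^ 2 + g ^ 3)%C).
  assert (HT : Cmod T <= 1014 / 100).
  { assert (x ^ 2 <= (10134 / 10000) ^ 2) by (apply pow_incr; lra).
    assert (x ^ 3 <= (10134 / 10000) ^ 3) by (apply pow_incr; lra).
    unfold T; eapply Rle_trans; [apply Cmod_triangle|].
    pose proof (Cmod_triangle (4 + 3 * g) (2 * g ^ 2)).
    pose proof (Cmod_triangle 4 (3 * g)).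
    rewrite !Cmod_mult, !Cmod_pow, !Cmod_R, Hg, !Rabs_pos_eq in * by lra; lra. }
  assert (H5 : 5 <= Cmod S + Cmod (g - 1)%C * Cmod T).
  { rewrite <- Cmod_mult, <- (Rabs_pos_eq 5), <- Cmod_R, <- (Cmod_opp ((g - 1) * T)) by lra.
    replace (RtoC 5) with (S + - ((g - 1) * T))%C; [apply Cmod_triangle|].
    unfold S, T.
    replace (RtoC 5) with (1 + 1 + 1 + 1 + 1)%C by (rewrite <- !RtoC_plus; f_equal; lra).
    replace (RtoC 4) with (1 + 1 + 1 + 1)%C by (rewrite <- !RtoC_plus; f_equal; lra).
    replace (RtoC 3) with (1 + 1 + 1)%C by (rewrite <- !RtoC_plus; f_equal; lra).
    replace (RtoC 2) with (1 + 1)%C by (rewrite <- !RtoC_plus; f_equal; lra).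
    ring. }
  assert (486 / 100 <= Cmod S) by nra.
  nra.
Qed.

(** * Arguments of sums and of the selected roots *)

(** After rotation by [-s], imaginary parts give [m sin w = b sin (t - s)] and
    [m sin (t - s - w) = a sin (t - s)]. Both are positive for [s < t], which rules out [w < 0] and
    [w > t - s]. *)
Lemma polar_sum_sector (a b s t : R) :
  0 < a -> 0 < b -> s <= t < s + PI ->
  exists m w : R, 0 < m /\ s <= w <= t /\
    (RtoC a * cis s + RtoC b * cis t)%C = (RtoC m * cis w)%C.
Proof.
  intros Ha Hb [[Hst|<-] Ht].
  2:{ exists (a + b), s; repeat split; try lra.
      rewrite RtoC_plus; ring. }
  destruct (polar_exists (RtoC a + RtoC b * cis (t - s))%C) as (m & w & Hm & Hw & E).
  assert (Hs : 0 < sin (t - s)) by (apply sin_gt_0; lra).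
  pose proof (f_equal fst E) as E1; pose proof (f_equal snd E) as E2.
  unfold cis in E1, E2; simpl in E1, E2.
  assert (E2' : m * sin w = b * sin (t - s)) by lra.
  assert (E3 : m * sin (t - s - w) = a * sin (t - s)).
  { rewrite sin_minus.
    transitivity (sin (t - s) * (m * cos w) - cos (t - s) * (m * sin w)); [ring|].
    rewrite E2'; replace (m * cos w) with (a + b * cos (t - s)) by lra; ring. }
  assert (0 < b * sin (t - s)) by now apply Rmult_lt_0_compat.
  assert (0 < a * sin (t - s)) by now apply Rmult_lt_0_compat.
  assert (Hm0 : 0 < m) by (destruct Hm as [Hm|<-]; lra).
  assert (Hw0 : 0 <= w).
  { apply Rnot_lt_le; intro H1.
    pose proof (sin_ge_0 (- w) ltac:(lra) ltac:(lra)) as H2; rewrite sin_neg in H2; nra. }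
  assert (Hw1 : w <= t - s).
  { apply Rnot_lt_le; intro H1.
    pose proof (sin_ge_0 (- (t - s - w)) ltac:(lra) ltac:(lra)) as H2.
    rewrite sin_neg in H2; nra. }
  exists m, (s + w); repeat split; try lra.
  replace (cis t) with (cis (s + (t - s))) by (f_equal; ring).
  rewrite !cis_add.
  transitivity (cis s * (RtoC a + RtoC b * cis (t - s)))%C; [ring|].
  rewrite E; ring.
Qed.

(** The sum [u + p] has an argument [w] in [[0, theta]], so the fourth root of argument [- w/4]
    respects the convention and uniqueness identifies it with [t0]. *)
Lemma t0_polar (xi theta p : R) :
  p = Rpower (xi / alpha) (2 / 9) -> 0 < xi -> 0 <= theta <= PI / 5 ->
  exists tau beta : R, 0 < tau /\ 0 <= beta <= theta / 4 /\
    t0 xi theta = (RtoC tau * cis (- beta))%C /\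
    (t0 xi theta ^ 4 * (cis theta + RtoC p))%C = RtoC (2 * xi).
Proof.
  intros Ep Hxi Hth; pose proof PI_RGT_0.
  assert (Hp : 0 < p) by (rewrite Ep; apply exp_pos).
  destruct (polar_sum_sector p 1 0 theta) as (m & w & Hm & Hw & E); try lra.
  rewrite cis_0, Cmult_1_r, Cmult_1_l, Cplus_comm in E.
  assert (Hq : 0 < 2 * xi / m) by (apply Rdiv_lt_0_compat; lra).
  destruct (pow_root_exists 4 (2 * xi / m)) as (tau & Htau & Et); [lia|lra|].
  assert (Htau0 : 0 < tau).
  { destruct Htau as [Htau|<-]; [exact Htau|]. rewrite pow_i in Et by lia; lra. }
  assert (Hmul : ((RtoC tau * cis (- (w / 4))) ^ 4 * (cis theta + RtoC p))%C
                 = RtoC (2 * xi)).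
  { rewrite E, Cpow_mult_l, cis_pow, <- RtoC_pow, Et.
    transitivity (RtoC (2 * xi / m * m) * (cis (INR 4 * - (w / 4)) * cis w))%C;
      [rewrite RtoC_mult; ring|].
    rewrite <- cis_add; replace (INR 4 * - (w / 4) + w) with 0 by (simpl; field).
    rewrite cis_0, Cmult_1_r; f_equal; field; lra. }
  assert (Hnz : (cis theta + RtoC p)%C <> 0).
  { rewrite E; intro H0; apply (f_equal Cmod) in H0.
    rewrite Cmod_polar, Cmod_0 in H0; lra. }
  assert (Et0 : t0 xi theta = (RtoC tau * cis (- (w / 4)))%C).
  { unfold t0; rewrite <- Ep.
    apply (is_nth_root_unique 4 (RtoC (2 * xi) / (cis theta + RtoC p))%C); [lia| |].
    - apply nth_root_spec; lia.
    - split; [rewrite <- Hmul; field; exact Hnz|].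
      exists tau, (- (w / 4)); replace (INR 4) with 4 by (simpl; ring).
      repeat split; lra. }
  exists tau, (w / 4); rewrite Et0; repeat split; auto; lra.
Qed.

(** Merges the two cases of the definition: [theta = 0] becomes [s = 0]. *)
Lemma distinguished_polar (xi theta : R) (y : C) :
  0 <= theta -> is_distinguished_root xi theta y ->
  exists r s : R, 0 < r /\ 0 <= s <= theta / 4 /\ y = (RtoC r * cis (- s))%C /\
    (y ^ 4 * (cis theta + y))%C = RtoC (2 * xi).
Proof.
  intros Hth (E & Hpos & Hzero).
  assert (E' : (y ^ 4 * (cis theta + y))%C = RtoC (2 * xi)).
  { rewrite RtoC_mult, <- E; field; intro H; injection H; lra. }
  destruct Hth as [Hth|Hth].
  - destruct (Hpos Hth) as (r & s & Hr & Hs & ->).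
    exists r, (- s); rewrite Ropp_involutive; repeat split; auto; lra.
  - destruct (Hzero (eq_sym Hth)) as (r & Hr & ->).
    exists r, 0; rewrite Ropp_0, cis_0, Cmult_1_r; repeat split; auto; lra.
Qed.

(* The branch cut of the fifth root, at argument -PI, is what has to be avoided here. *)
Lemma polar_upper_arg5_nonneg (x psi : R) :
  0 <= x -> - (PI / 5) <= psi < PI / 5 ->
  let z := ((RtoC x * cis psi) ^ 5)%C in
  0 < snd z \/ (snd z = 0 /\ 0 < fst z) -> 0 <= psi.
Proof.
  intros Hx Hpsi z Hz; unfold z in Hz; clear z.
  rewrite Cpow_mult_l, cis_pow, <- RtoC_pow in Hz; unfold cis in Hz.
  replace (INR 5) with 5 in Hz by (simpl; ring); simpl in Hz.
  pose proof (pow_le x 5 Hx) as H5; simpl in H5.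
  apply Rnot_lt_le; intro Hneg.
  assert (Hs : 0 <= sin (- (5 * psi))) by (apply sin_ge_0; lra).
  rewrite sin_neg in Hs.
  destruct Hz as [Hz|[Hz Hc]]; [nra|].
  (* At [psi = - PI/5] the fifth power falls on the negative real axis: its imaginary part vanishes
     and only the sign of the real part excludes it. *)
  destruct (Req_dec psi (- (PI / 5))) as [->|Hne].
  - replace (5 * - (PI / 5)) with (- PI) in Hc by field.
    rewrite cos_neg, cos_PI in Hc; nra.
  - assert (Hs' : 0 < sin (- (5 * psi))) by (apply sin_gt_0; lra).
    rewrite sin_neg in Hs'.
    assert (Hx5 : x * (x * (x * (x * (x * 1)))) = 0) by nra.
    rewrite Hx5 in Hc; lra.
Qed.

(** * The constant [alpha] and the comparison of [p] with [r] *)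

Lemma sqrt2_bounds : 14142 / 10000 <= sqrt 2 <= 14143 / 10000.
Proof.
  pose proof (sqrt_sqrt 2 ltac:(lra)); pose proof (sqrt_pos 2); nra.
Qed.

Lemma two_cos_PI4 : 2 * cos (PI / 4) = sqrt 2.
Proof.
  rewrite cos_PI4.
  pose proof sqrt2_bounds; pose proof (sqrt_sqrt 2 ltac:(lra)).
  apply (Rmult_eq_reg_r (sqrt 2)); [field_simplify; nra|lra].
Qed.

(** The ninth power clears the exponent: [p^9 = (xi/alpha)^2], and [4 alpha^2 = 2 + sqrt 2]. *)
Lemma Rpower_2_9_pow9 (xi r rho p : R) :
  0 < xi -> 2 * xi = r ^ 4 * rho -> p = Rpower (xi / alpha) (2 / 9) ->
  p ^ 9 * (2 + sqrt 2) = r ^ 8 * rho ^ 2.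
Proof.
  intros Hxi E ->; pose proof sqrt2_bounds.
  assert (Ha : 0 < alpha) by (apply sqrt_lt_R0; lra).
  assert (Ha2 : alpha ^ 2 = (2 + sqrt 2) / 4) by (unfold alpha; apply pow2_sqrt; lra).
  assert (Hq : 0 < xi / alpha) by now apply Rdiv_lt_0_compat.
  rewrite <- Rpower_pow, Rpower_mult by apply exp_pos.
  replace (2 / 9 * INR 9) with (INR 2) by (simpl; field).
  rewrite Rpower_pow by exact Hq.
  transitivity ((2 * xi) ^ 2); [|rewrite E; ring].
  replace (2 + sqrt 2) with (4 * alpha ^ 2) by (rewrite Ha2; field).
  field; lra.
Qed.

(** From [(r - 1)^2 >= 0], [rho^2 >= (2 + sqrt 2) r], so [p^9 >= r^9]; equality at [r = 1] explains
    the choice of [alpha]. The upper bound linearizes [p^9] at [r] and uses [3.414 < 2 + sqrt 2]. *)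
Lemma ninth_root_bounds (r rho p : R) :
  0 < r -> 0 < p -> p ^ 9 * (2 + sqrt 2) = r ^ 8 * rho ^ 2 ->
  1 + sqrt 2 * r + r ^ 2 <= rho ^ 2 <= (1 + r) ^ 2 ->
  r <= p <= r + ((1 + r) ^ 2 / (3414 / 1000) - r) / 9.
Proof.
  intros Hr Hp E Hrho; pose proof sqrt2_bounds as Hs.
  pose proof (pow_lt r 8 Hr) as Hr8.
  assert (Hrp : r <= p).
  { apply Rnot_lt_le; intro Hlt.
    assert (H9 : p ^ 9 < r ^ 9).
    { change (p * p ^ 8 < r * r ^ 8).
      apply Rle_lt_trans with (p * r ^ 8); [|now apply Rmult_lt_compat_r].
      apply Rmult_le_compat_l; [lra|]; apply pow_incr; lra. }
    assert ((2 + sqrt 2) * r <= rho ^ 2) by (pose proof (pow2_ge_0 (r - 1)); lra).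
    replace (r ^ 9) with (r ^ 8 * r) in H9 by ring.
    assert (p ^ 9 * (2 + sqrt 2) < r ^ 8 * r * (2 + sqrt 2)) by nra.
    assert (r ^ 8 * ((2 + sqrt 2) * r) <= r ^ 8 * rho ^ 2) by nra.
    lra. }
  split; [exact Hrp|].
  (* Bernoulli's inequality: the power lies above its tangent at [r]. *)
  assert (Hb : forall n, r ^ S n + INR (S n) * r ^ n * (p - r) <= p ^ S n).
  { induction n as [|n IH]; [simpl; lra|].
    rewrite S_INR; change (p ^ S (S n)) with (p * p ^ S n).
    assert (H0 : 0 <= r ^ n * (p - r) * INR (S n) * (p - r)).
    { pose proof (pow_lt r n Hr); pose proof (pos_INR (S n)).
      repeat apply Rmult_le_pos; lra. }
    pose proof (Rmult_le_compat_l p _ _ ltac:(lra) IH) as H1.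
    simpl in *; lra. }
  specialize (Hb 8%nat); replace (INR 9) with 9 in Hb by (simpl; ring).
  assert (H1 : p ^ 9 * (3414 / 1000) <= r ^ 8 * (1 + r) ^ 2).
  { pose proof (pow_lt p 9 Hp).
    apply Rle_trans with (p ^ 9 * (2 + sqrt 2)); [nra|].
    rewrite E; nra. }
  assert (H2 : r ^ 8 * (r + 9 * (p - r)) <= r ^ 8 * ((1 + r) ^ 2 / (3414 / 1000)))
    by (simpl in *; lra).
  apply Rmult_le_reg_l in H2; lra.
Qed.

(** By the law of cosines the left side is [(p - r)^2 + 2 r p (1 - cos s)], and
    [2 (1 - cos s) <= s^2 <= 249/10000]. *)
Lemma dist_to_positive_sqr (r s p a : R) :
  0 < r -> 0 <= s <= PI / 20 -> r <= p <= r + a ->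
  Cmod (RtoC r * cis (- s) - RtoC p)%C ^ 2 <= a ^ 2 + 249 / 10000 * r * (r + a).
Proof.
  intros Hr Hs Hp; pose proof PI_lt_315.
  replace (RtoC r * cis (- s) - RtoC p)%C
    with (RtoC r * cis (- s) + RtoC (- p) * cis 0)%C
    by (rewrite cis_0, RtoC_opp; ring).
  rewrite Cmod_polar_add_sqr, Rminus_0_r, cos_neg.
  pose proof (cos_ge_quadratic s); assert (s ^ 2 <= 249 / 10000) by nra.
  assert (0 < r * p) by nra.
  assert (Hc1 : 2 * (r * p) * (1 - cos s) <= r * p * (249 / 10000)) by nra.
  assert (Hc2 : r * p <= r * (r + a)) by nra.
  assert (Hc3 : (p - r) ^ 2 <= a ^ 2) by nra.
  lra.
Qed.

(** * The ratio of the fourth roots *)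

(** Everything follows from [x^4 * Cmod d = rho]: first with [rho <= Cmod d], then with
    [Cmod d <= rho + X] and [1 + e <= (1 + e/4)^4]. The last bound factors [c - d = (h^4 - 1) d]. *)
Lemma root4_estimate (x phi rho X : R) (h c d : C) :
  h = (RtoC x * cis phi)%C -> 0 < x -> Rabs phi <= PI / 20 ->
  (h ^ 4 * d)%C = c -> rho = Cmod c -> X = Cmod (c - d)%C ->
  0 < rho <= Cmod d ->
  x <= 1 /\ 1 <= x * (1 + X / rho / 4) /\
  Cmod (h - 1)%C * rho * (971 / 1000 * (1 + x ^ 3) + 996 / 1000 * (x + x ^ 2)) <= X.
Proof.
  intros Eh Hx Hphi E Erho EX Hrho.
  pose proof (geom4_polar_lower x phi ltac:(lra) Hphi) as Hlow.
  rewrite <- Eh in Hlow; set (S := (1 + h + h ^ 2 + h ^ 3)%C) in *.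
  assert (Hh : Cmod h = x) by (rewrite Eh; apply Cmod_polar; lra).
  assert (E4 : x ^ 4 * Cmod d = rho) by (rewrite Erho, <- E, Cmod_mult, Cmod_pow, Hh; ring).
  assert (HX0 : 0 <= X) by (rewrite EX; apply Cmod_ge_0).
  split; [|split].
  - apply Rnot_lt_le; intro H1.
    assert (1 < x ^ 4) by (apply Rlt_pow_R1; [exact H1|lia]); nra.
  - assert (Hd : Cmod d <= rho + X).
    { rewrite Erho, EX; replace d with (c + - (c - d))%C at 1 by ring.
      eapply Rle_trans; [apply Cmod_triangle|]; rewrite Cmod_opp; lra. }
    set (e := X / rho).
    assert (He : X = rho * e) by (unfold e; field; lra).
    assert (He0 : 0 <= e) by (apply Rdiv_le_0_compat; lra).
    assert (H4 : 1 <= x ^ 4 * (1 + e)).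
    { apply (Rmult_le_reg_l rho); [lra|]; rewrite <- E4 at 1.
      pose proof (pow_lt x 4 Hx); nra. }
    apply Rnot_lt_le; intro H1.
    assert (Hlt : (x * (1 + e / 4)) ^ 4 < 1).
    { assert (0 <= x * (1 + e / 4)) by nra.
      set (v := x * (1 + e / 4)) in *. assert (v ^ 2 < 1) by nra.
      replace (v ^ 4) with (v ^ 2 * v ^ 2) by ring; pose proof (pow2_ge_0 v); nra. }
    rewrite Rpow_mult_distr in Hlt.
    assert (1 + e <= (1 + e / 4) ^ 4).
    { pose proof (pow_le e 2 He0); pose proof (pow_le e 3 He0); pose proof (pow_le e 4 He0).
      simpl in *; lra. }
    pose proof (pow_lt x 4 Hx); nra.
  - assert (EX' : X = Cmod (h - 1)%C * Cmod S * Cmod d).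
    { rewrite EX, <- !Cmod_mult; f_equal; rewrite <- E; unfold S; ring. }
    rewrite EX'; pose proof (Cmod_ge_0 (h - 1)%C).
    rewrite !Rmult_assoc; apply Rmult_le_compat_l; [assumption|].
    rewrite (Rmult_comm rho); apply Rmult_le_compat; try lra.
    pose proof (pow_lt x 2 Hx); pose proof (pow_lt x 3 Hx); lra.
Qed.

(** * The radicand of the fifth root *)

(** The radicand of [y1] with [t0] made a variable, so that it can be evaluated at the exact root
    too. *)
Definition quintic_rhs (xi : R) (u t : C) : C :=
  (RtoC (2 * xi) + 2 * u ^ 2 / 5 * t ^ 3 + 2 * u ^ 3 / 25 * t ^ 2
   + u ^ 4 / 125 * t + u ^ 5 / 3125)%C.

(* [ring] and [field] over C treat the embedded real numerals as atoms. *)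
Ltac C_numerals :=
  replace (RtoC 3125) with (RtoC 5 ^ 5)%C by (rewrite <- RtoC_pow; f_equal; lra);
  replace (RtoC 125) with (RtoC 5 ^ 3)%C by (rewrite <- RtoC_pow; f_equal; lra);
  replace (RtoC 25) with (RtoC 5 ^ 2)%C by (rewrite <- RtoC_pow; f_equal; lra);
  replace (RtoC 5) with (1 + 1 + 1 + 1 + 1)%C by (rewrite <- !RtoC_plus; f_equal; lra);
  replace (RtoC 2) with (1 + 1)%C by (rewrite <- !RtoC_plus; f_equal; lra).

(** The expansion of [(y + u/5)^5] begins with [y^5 + u y^4], which the equation turns into
    [2 xi]. *)
Lemma quintic_rhs_root (xi : R) (u y : C) :
  (y ^ 4 * (u + y))%C = RtoC (2 * xi) -> quintic_rhs xi u y = ((y + u / 5) ^ 5)%C.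
Proof.
  intros E; unfold quintic_rhs; rewrite <- E; C_numerals; field.
Qed.

(** Divided differences: the coefficients are [3 * 2/5], [2 * 2/25] and [1/125]. *)
Lemma quintic_rhs_lipschitz (xi r : R) (u t y : C) :
  Cmod u = 1 -> Cmod t <= r -> Cmod y <= r ->
  Cmod (quintic_rhs xi u t - quintic_rhs xi u y)%C
    <= Cmod (t - y)%C * (12 / 10 * r ^ 2 + 16 / 100 * r + 8 / 1000).
Proof.
  intros Hu Ht Hy.
  set (A := (RtoC (2 / 5) * u ^ 2 * (t ^ 2 + t * y + y ^ 2))%C).
  set (B := (RtoC (2 / 25) * u ^ 3 * (t + y))%C).
  set (D := (RtoC (1 / 125) * u ^ 4)%C).
  replace (quintic_rhs xi u t - quintic_rhs xi u y)%C with ((t - y) * (A + B + D))%C.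
  2:{ unfold quintic_rhs, A, B, D; rewrite !RtoC_div by lra.
      unfold Cdiv; ring. }
  rewrite Cmod_mult; apply Rmult_le_compat_l; [apply Cmod_ge_0|].
  pose proof (Cmod_ge_0 t); pose proof (Cmod_ge_0 y).
  assert (HA : Cmod A <= 12 / 10 * r ^ 2).
  { unfold A; rewrite !Cmod_mult, Cmod_pow, Hu, Cmod_R, Rabs_pos_eq, pow1 by lra.
    pose proof (Cmod_triangle (t ^ 2 + t * y) (y ^ 2)).
    pose proof (Cmod_triangle (t ^ 2) (t * y)).
    rewrite Cmod_mult, !Cmod_pow in *.
    assert (Cmod t ^ 2 <= r ^ 2) by (apply pow_incr; lra).
    assert (Cmod y ^ 2 <= r ^ 2) by (apply pow_incr; lra).
    assert (Cmod t * Cmod y <= r * r) by (apply Rmult_le_compat; lra).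
    lra. }
  assert (HB : Cmod B <= 16 / 100 * r).
  { unfold B; rewrite !Cmod_mult, Cmod_pow, Hu, Cmod_R, Rabs_pos_eq, pow1 by lra.
    pose proof (Cmod_triangle t y); lra. }
  assert (HD : Cmod D = 8 / 1000).
  { unfold D; rewrite Cmod_mult, Cmod_pow, Hu, Cmod_R, Rabs_pos_eq, pow1 by lra; lra. }
  pose proof (Cmod_triangle (A + B) D); pose proof (Cmod_triangle A B); lra.
Qed.

(** Every summand has its argument in [[0, PI]], and for [theta > 0] the cubic one lies strictly
    above the real axis; for [theta = 0] all are positive reals. *)
Lemma quintic_rhs_upper (xi theta tau beta : R) :
  0 < xi -> 0 <= theta <= PI / 5 -> 0 < tau -> 0 <= beta <= theta / 4 ->
  let z := quintic_rhs xi (cis theta) (RtoC tau * cis (- beta))%C in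
  0 < snd z \/ (snd z = 0 /\ 0 < fst z).
Proof.
  intros Hxi Hth Htau Hb z.
  assert (Ez : z = (RtoC (2 * xi) * cis 0
    + RtoC (2 / 5 * tau ^ 3) * cis (2 * theta - 3 * beta)
    + RtoC (2 / 25 * tau ^ 2) * cis (3 * theta - 2 * beta)
    + RtoC (1 / 125 * tau) * cis (4 * theta - beta)
    + RtoC (1 / 3125) * cis (5 * theta))%C).
  { unfold z, quintic_rhs; rewrite !Cpow_mult_l, !cis_pow, cis_0.
    replace (2 * theta - 3 * beta) with (INR 2 * theta + INR 3 * - beta) by (simpl; ring).
    replace (3 * theta - 2 * beta) with (INR 3 * theta + INR 2 * - beta) by (simpl; ring).
    replace (4 * theta - beta) with (INR 4 * theta + - beta) by (simpl; ring).
    replace (5 * theta) with (INR 5 * theta) by (simpl; ring).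
    rewrite !cis_add, !RtoC_mult, !RtoC_div, !RtoC_pow by lra; unfold Cdiv; ring. }
  pose proof (pow_lt tau 2 Htau) as H2; pose proof (pow_lt tau 3 Htau) as H3.
  pose proof PI_RGT_0.
  rewrite Ez; unfold cis; simpl.
  destruct (proj1 Hth) as [Ht|Ht].
  - left.
    assert (0 < sin (2 * theta - 3 * beta)) by (apply sin_gt_0; lra).
    assert (0 <= sin (3 * theta - 2 * beta)) by (apply sin_ge_0; lra).
    assert (0 <= sin (4 * theta - beta)) by (apply sin_ge_0; lra).
    assert (0 <= sin (5 * theta)) by (apply sin_ge_0; lra).
    rewrite sin_0; simpl in *.
    assert (0 < 2 / 5 * (tau * (tau * (tau * 1))) * sin (2 * theta - 3 * beta)) by nra.
    assert (0 <= 2 / 25 * (tau * (tau * 1)) * sin (3 * theta - 2 * beta)) by nra.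
    assert (0 <= 1 / 125 * tau * sin (4 * theta - beta)) by nra.
    lra.
  - right; subst theta; assert (beta = 0) by lra; subst beta.
    replace (2 * 0 - 3 * 0) with 0 by ring; replace (3 * 0 - 2 * 0) with 0 by ring.
    replace (4 * 0 - 0) with 0 by ring; replace (5 * 0) with 0 by ring.
    rewrite sin_0, cos_0; simpl in *; split; lra.
Qed.

(** * Polynomial inequalities in [r] *)

(* 326/10000 exceeds 1/(9 * 3.414), the constant of [ninth_root_bounds] from 3.414 < 2 + sqrt 2. *)
Definition gap_bound (r : R) : R := 326 / 10000 * (1 - 1414 / 1000 * r + r ^ 2).

Definition dist_sq_bound (r : R) : R :=
  gap_bound r ^ 2 + 249 / 10000 * r * (r + gap_bound r).

(** Lower bound for [rho^2]; [141/100] is below [sqrt 2 = 2 cos (PI/4)]. *)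
Definition shift_sq_bound (r : R) : R := 1 + 141 / 100 * r + r ^ 2.

(** Lower bound for the squared modulus of [ystar + u/5]; [28/100] is below [2/5 * cos (PI/4)]. *)
Definition root_sq_bound (r : R) : R := r ^ 2 + 28 / 100 * r + 4 / 100.

Definition lip_bound (r : R) : R := 12 / 10 * r ^ 2 + 16 / 100 * r + 8 / 1000.

(* Coefficient [c_i] multiplies [x^i y^(n-i)]; on an interval [lo, hi] it is used with
   x = r - lo and y = hi - r. *)
Fixpoint bernstein (cs : list R) (x y : R) : R :=
  match cs with
  | [] => 0
  | c :: cs => c * y ^ length cs + x * bernstein cs x y
  end.

Lemma bernstein_nonneg (cs : list R) (x y : R) :
  0 <= x -> 0 <= y -> List.Forall (Rle 0) cs -> 0 <= bernstein cs x y.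
Proof.
  intros Hx Hy; induction 1 as [|c cs Hc Hcs IH]; simpl; [lra|].
  apply Rplus_le_le_0_compat; apply Rmult_le_pos; auto; now apply pow_le.
Qed.

(** The factor [k] clears denominators, so the coefficients can be integers. *)
Lemma bernstein_certificate (k : R) (cs : list R) (x y a b : R) :
  0 <= k -> 0 <= x -> 0 <= y -> List.Forall (Rle 0) cs ->
  b - a = k * bernstein cs x y -> a <= b.
Proof.
  intros Hk Hx Hy Hcs E.
  pose proof (Rmult_le_pos _ _ Hk (bernstein_nonneg cs x y Hx Hy Hcs)); lra.
Qed.

(** Here [256/10000 = (16/100)^2], so that [X / rho <= 16/100]. *)
Lemma dist_shift_small (r : R) :
  0 <= r <= 4 -> dist_sq_bound r <= 256 / 10000 * shift_sq_bound r.
Proof.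
  intros Hr.
  apply (bernstein_certificate (1 / 100000000000000)
    [9584859375; 98167164500; 221976101419; 242633778838; 2963982544]
    r (4 - r));
    [lra|lra|lra|repeat constructor; lra|].
  unfold dist_sq_bound, gap_bound, shift_sq_bound; simpl; field.
Qed.

(** Here [37/10 < (193/100)^2], so that [X / rho <= 193/100]. *)
Lemma dist_shift_large (r : R) :
  4 <= r <= 60 -> dist_sq_bound r <= 37 / 10 * shift_sq_bound r.
Proof.
  intros Hr.
  apply (bernstein_certificate (1 / 960400000000000000)
    [8124609745636; 220778785262227; 1714954771661146; 2546073014070155;
     23097713925600]
    (r - 4) (60 - r));
    [lra|lra|lra|repeat constructor; lra|].
  unfold dist_sq_bound, gap_bound, shift_sq_bound; simpl; field.
Qed.

(** Squared form of [lip_bound r * r * e <= 209/10000 * V^4]. The factor [37/10] is a lower bound of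
    the geometric sum for [r <= 4]. *)
Lemma error_poly_unit (r : R) :
  0 <= r <= 1 ->
  (lip_bound r * r) ^ 2 * dist_sq_bound r
    <= (37 / 10 * (209 / 10000 * root_sq_bound r ^ 2)) ^ 2 * shift_sq_bound r.
Proof.
  intros Hr.
  apply (bernstein_certificate (1 / 390625000000000000)
    [5979928900; 235668997949; 4423514689513; 50865549541046; 389954677585378;
     2057739297530495; 7510960573500379; 17996389482637778; 16660349060201606;
     8088090921590553; 5365734340954545]
    r (1 - r));
    [lra|lra|lra|repeat constructor; lra|].
  unfold dist_sq_bound, gap_bound, shift_sq_bound, lip_bound, root_sq_bound; simpl; field.
Qed.

Lemma error_poly_middle (r : R) :
  1 <= r <= 4 ->
  (lip_bound r * r) ^ 2 * dist_sq_bound r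
    <= (37 / 10 * (209 / 10000 * root_sq_bound r ^ 2)) ^ 2 * shift_sq_bound r.
Proof.
  intros Hr.
  apply (bernstein_certificate (1 / 2562890625000000000000)
    [596192704550505; 21151677874823349; 348862005277478570; 3504988515481030282;
     23577199172735127371; 110020320391013522563; 357730302172861555694;
     794313541137181753150; 1144727734375880324777; 960156550488731585161;
     353035579804300240088]
    (r - 1) (4 - r));
    [lra|lra|lra|repeat constructor; lra|].
  unfold dist_sq_bound, gap_bound, shift_sq_bound, lip_bound, root_sq_bound; simpl; field.
Qed.

(** The geometric sum is bounded below only by [237/100] on this range. *)
Lemma error_poly_large (r : R) :
  4 <= r <= 60 ->
  (lip_bound r * r) ^ 2 * dist_sq_bound r
    <= (237 / 100 * (209 / 10000 * root_sq_bound r ^ 2)) ^ 2 * shift_sq_bound r.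
Proof.
  intros Hr.
  apply (bernstein_certificate (1 / 1480983833477120000000000000000000000)
    [5914027084689386624547; 1016281226663791906635777; 75253946444502467787167842;
     3194049402712128240823662292; 86518395961616403681150659762;
     1566885651422126849221718178862; 19225272544093822121362373409392;
     157598605916874854499371141563492; 823121260886976737995614043118227;
     2456466495828621283088028106477977; 3140362934761139809016518955538630]
    (r - 4) (60 - r));
    [lra|lra|lra|repeat constructor; lra|].
  unfold dist_sq_bound, gap_bound, shift_sq_bound, lip_bound, root_sq_bound; simpl; field.
Qed.

(** Serves the smallness hypothesis of [root5_stable]: [276/10000 = 3/100 * 92/100], and
    [V >= 92/100 * (r + 2/10)]. *)
Lemma relative_error_poly (r : R) :
  0 <= r <= 3 / 4 ->
  (lip_bound r * r) ^ 2 * dist_sq_bound r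
    <= (37 / 10 * (276 / 10000 * (root_sq_bound r ^ 2 * (r + 2 / 10)))) ^ 2
       * shift_sq_bound r.
Proof.
  intros Hr.
  apply (bernstein_certificate (1 / 9010162353515625000000)
    [303751915110400; 12623170212200448; 236681603143172096; 2600418462060576768;
     18198670007496314880; 85485754840066068480; 286145222153956267008;
     697052995524404119296; 666749752395338419008; 118601505699317726800;
     1090296753837694108200; 2616491155670100141575; 1552579497263345957400]
    r (3 / 4 - r));
    [lra|lra|lra|repeat constructor; lra|].
  unfold dist_sq_bound, gap_bound, shift_sq_bound, lip_bound, root_sq_bound; simpl; field.
Qed.

(** * From squared inequalities to the scalar error bound *)

(** [X] and [rho] are controlled through their squares only; squaring the claim leaves a polynomial
    inequality free of square roots. *)
Lemma sqrt_free_bound (e rho S X K B N Q : R) :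
  0 <= e -> 0 < rho -> 0 < S -> 0 <= K -> 0 <= B ->
  e * rho * S <= X -> X ^ 2 <= N -> Q <= rho ^ 2 ->
  K ^ 2 * N <= (S * B) ^ 2 * Q -> K * e <= B.
Proof.
  intros He Hrho HS HK HB HX HN HQ H.
  apply Rnot_lt_le; intro Hlt.
  assert (H1 : (K * e * (rho * S)) ^ 2 <= K ^ 2 * N).
  { apply Rle_trans with (K ^ 2 * X ^ 2).
    - rewrite <- Rpow_mult_distr; apply pow_incr; split.
      + pose proof (Rmult_lt_0_compat _ _ Hrho HS); nra.
      + pose proof (Rmult_le_compat_l K _ _ HK HX); lra.
    - apply Rmult_le_compat_l; [apply pow2_ge_0|exact HN]. }
  assert (H2 : (S * B) ^ 2 * Q <= (B * (rho * S)) ^ 2).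
  { replace ((B * (rho * S)) ^ 2) with ((S * B) ^ 2 * rho ^ 2) by ring.
    apply Rmult_le_compat_l; [apply pow2_ge_0|exact HQ]. }
  pose proof (Rmult_lt_0_compat _ _ Hrho HS) as HrS.
  assert (H3 : B * (rho * S) < K * e * (rho * S)) by now apply Rmult_lt_compat_r.
  assert (0 <= B * (rho * S)) by (apply Rmult_le_pos; lra).
  nra.
Qed.

Lemma root4_ratio_lower (x X rho N Q d : R) :
  0 < x -> 0 <= X -> 0 < rho -> 0 <= d ->
  X ^ 2 <= N -> Q <= rho ^ 2 -> N <= d ^ 2 * Q ->
  1 <= x * (1 + X / rho / 4) -> 1 <= x * (1 + d / 4).
Proof.
  intros Hx HX Hrho Hd HN HQ HNQ H.
  assert (HXd : X <= d * rho).
  { assert (X ^ 2 <= (d * rho) ^ 2).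
    { rewrite Rpow_mult_distr.
      pose proof (Rmult_le_compat_l (d ^ 2) _ _ (pow2_ge_0 d) HQ); lra. }
    assert (0 <= d * rho) by (apply Rmult_le_pos; lra); nra. }
  assert (X / rho <= d) by (apply Rle_div_l; lra).
  nra.
Qed.

(** The first conclusion yields the final constant, the second the hypothesis [3/100] of
    [root5_stable]. *)
Lemma scalar_error_bound (r x X rho e V : R) :
  0 < r -> 0 < x -> 0 <= X -> 0 < rho -> 0 <= e <= 1 -> 0 < V ->
  X ^ 2 <= dist_sq_bound r -> shift_sq_bound r <= rho ^ 2 ->
  root_sq_bound r <= V ^ 2 ->
  1 <= x * (1 + X / rho / 4) ->
  e * rho * (971 / 1000 * (1 + x ^ 3) + 996 / 1000 * (x + x ^ 2)) <= X ->
  lip_bound r * r * e <= 209 / 10000 * V ^ 4 /\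
  lip_bound r * r * e <= 3 / 100 * V ^ 5.
Proof.
  intros Hr Hx HX Hrho He HV HN HQ HW Hxd HeX.
  assert (HK : 0 <= lip_bound r * r) by (unfold lip_bound; nra).
  assert (HW0 : 0 < root_sq_bound r) by (unfold root_sq_bound; nra).
  assert (HW2 : root_sq_bound r ^ 2 <= V ^ 4).
  { replace (V ^ 4) with ((V ^ 2) ^ 2) by ring; apply pow_incr; lra. }
  assert (HW20 : 0 < root_sq_bound r ^ 2) by now apply pow_lt.
  assert (HVr : 92 / 100 * (r + 2 / 10) <= V).
  { assert ((92 / 100 * (r + 2 / 10)) ^ 2 <= V ^ 2).
    (* The difference of the two quadratics is minimal at [r = 61/320], and positive there. *)
    { unfold root_sq_bound in HW; pose proof (pow2_ge_0 (r - 61 / 320)); lra. }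
    nra. }
  set (S := 971 / 1000 * (1 + x ^ 3) + 996 / 1000 * (x + x ^ 2)) in *.
  assert (HS : forall c, 0 <= c <= x ->
    971 / 1000 * (1 + c ^ 3) + 996 / 1000 * (c + c ^ 2) <= S).
  { intros c Hc; pose proof (pow_incr c x 2 Hc); pose proof (pow_incr c x 3 Hc).
    unfold S; lra. }
  assert (Hkey : forall S0 B, 0 < S0 <= S -> 0 <= B ->
    (lip_bound r * r) ^ 2 * dist_sq_bound r <= (S0 * B) ^ 2 * shift_sq_bound r ->
    lip_bound r * r * e <= B).
  { intros S0 B HS0 HB.
    apply (sqrt_free_bound e rho S0 X); try lra; try assumption.
    apply Rle_trans with (e * rho * S); [|exact HeX].
    apply Rmult_le_compat_l; [apply Rmult_le_pos|]; lra. }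
  assert (H4 : lip_bound r * r * e <= 209 / 10000 * V ^ 4).
  { destruct (Rle_lt_dec r 4) as [H4|H4]; [|destruct (Rle_lt_dec r 60) as [H60|H60]].
    - apply Rle_trans with (209 / 10000 * root_sq_bound r ^ 2); [|lra].
      apply (Hkey (37 / 10)); [| lra |].
      + pose proof (root4_ratio_lower x X rho _ _ (16 / 100) Hx HX Hrho ltac:(lra) HN HQ)
          as Hc.
        pose proof (dist_shift_small r ltac:(lra)).
        (* [961/1000 < 1 / (1 + 0.16/4)], and the sum at this point exceeds [37/10]. *)
        specialize (HS (961 / 1000) ltac:(lra)); lra.
      + destruct (Rle_lt_dec r 1); [apply error_poly_unit|apply error_poly_middle]; lra.
    - apply Rle_trans with (209 / 10000 * root_sq_bound r ^ 2); [|lra].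
      apply (Hkey (237 / 100)); [| lra |].
      + pose proof (root4_ratio_lower x X rho _ _ (193 / 100) Hx HX Hrho ltac:(lra) HN HQ)
          as Hc.
        pose proof (dist_shift_large r ltac:(lra)).
        assert (0 <= shift_sq_bound r) by (unfold shift_sq_bound; nra).
        (* [67/100 < 1 / (1 + 1.93/4)], and the sum at this point exceeds [237/100]. *)
        specialize (HS (67 / 100) ltac:(lra)); lra.
      + apply error_poly_large; lra.
    (* Only [e <= 1] is used: past 60 the quartic wins, as [60 * 209/10000 > 12/10]. *)
    - apply Rle_trans with (lip_bound r * r); [nra|].
      apply Rle_trans with (209 / 10000 * root_sq_bound r ^ 2); [|lra].
      unfold lip_bound, root_sq_bound.
      apply Rle_trans with (209 / 10000 * (r ^ 3 * 60 + 56 / 100 * r ^ 3)); [|].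
      + assert (60 * r ^ 2 <= r ^ 3) by (pose proof (pow_lt r 2 Hr); simpl in *; nra).
        nra.
      + assert (60 * r ^ 3 <= r ^ 4) by (pose proof (pow_lt r 3 Hr); simpl in *; nra).
        nra. }
  split; [exact H4|].
  destruct (Rle_lt_dec r (3 / 4)) as [H34|H34].
  - apply Rle_trans with (276 / 10000 * (root_sq_bound r ^ 2 * (r + 2 / 10))).
    + apply (Hkey (37 / 10)).
      * pose proof (root4_ratio_lower x X rho _ _ (16 / 100) Hx HX Hrho ltac:(lra) HN HQ)
          as Hc.
        pose proof (dist_shift_small r ltac:(lra)).
        specialize (HS (961 / 1000) ltac:(lra)); lra.
      * nra.
      * apply relative_error_poly; lra.
    + replace (V ^ 5) with (V ^ 4 * V) by ring.
      assert (root_sq_bound r ^ 2 * (92 / 100 * (r + 2 / 10)) <= V ^ 4 * V)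
        by (apply Rmult_le_compat; lra).
      lra.
  (* Here [V >= 0.92 * 0.95], which exceeds [209/300], so the first bound implies the second. *)
  - replace (V ^ 5) with (V ^ 4 * V) by ring.
    pose proof (pow_lt V 4 HV); nra.
Qed.

(** * Polar quotients and the final assembly *)

Lemma Cmult_cancel_r (a b z : C) : z <> 0 -> (a * z)%C = (b * z)%C -> a = b.
Proof.
  intros Hz E; transitivity (a * z / z)%C; [field; exact Hz|].
  rewrite E; field; exact Hz.
Qed.

Lemma polar_div (a b s t : R) :
  0 < b ->
  (RtoC a * cis s / (RtoC b * cis t))%C = (RtoC (a / b) * cis (s - t))%C.
Proof.
  intros Hb.
  assert (H0 : (RtoC b * cis t)%C <> 0).
  { intro E; apply (f_equal Cmod) in E; rewrite Cmod_polar, Cmod_0 in E; lra. }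
  apply (Cmult_cancel_r _ _ _ H0).
  transitivity (RtoC a * cis s)%C; [unfold Cdiv; rewrite <- Cmult_assoc, Cinv_l by exact H0; ring|].
  transitivity (RtoC (a / b * b) * (cis (s - t) * cis t))%C; [|rewrite RtoC_mult; ring].
  rewrite <- cis_add; f_equal; f_equal; [field; lra|ring].
Qed.

Theorem mainTheorem1 :
  forall (xi theta : R) (ystar : C),
    0 < xi ->
    0 <= theta <= PI / 5 ->
    is_distinguished_root xi theta ystar ->
    Cmod (y1 xi theta - ystar)%C < 432 / 100000.
Proof.
  intros xi theta y Hxi Hth Hy.
  destruct (distinguished_polar xi theta y (proj1 Hth) Hy) as (r & s & Hr & Hs & Ey & Eqy).
  set (p := Rpower (xi / alpha) (2 / 9)).
  assert (Hp0 : 0 < p) by apply exp_pos.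
  destruct (t0_polar xi theta p eq_refl Hxi Hth) as (tau & beta & Htau & Hb & Et & Eqt).
  pose proof PI_RGT_0 as Hpi; pose proof PI_lt_315; pose proof sqrt2_bounds as Hs2.
  set (u := cis theta) in *; set (t := t0 xi theta) in *.
  assert (Hu : Cmod u = 1) by apply Cmod_cis.
  assert (Hmy : Cmod y = r) by (rewrite Ey; apply Cmod_polar; lra).
  assert (Hmt : Cmod t = tau) by (rewrite Et; apply Cmod_polar; lra).
  (* The angle between [u] and [y] is [theta + s <= PI/5 + PI/20 = PI/4]. *)
  assert (Hcos : sqrt 2 / 2 <= cos (theta + s)).
  { rewrite <- two_cos_PI4.
    replace (2 * cos (PI / 4) / 2) with (cos (PI / 4)) by field.
    apply cos_decr_1; lra. }
  pose proof (COS_bound (theta + s)) as Hcos1.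
  set (rho := Cmod (u + y)%C).
  assert (Erho : rho ^ 2 = 1 + 2 * r * cos (theta + s) + r ^ 2).
  { unfold rho, u; rewrite Ey.
    replace (cis theta) with (RtoC 1 * cis theta)%C by ring.
    rewrite Cmod_polar_add_sqr; unfold Rminus; rewrite Ropp_involutive; ring. }
  assert (Hrho0 : 0 < rho) by (pose proof (Cmod_ge_0 (u + y)%C); fold rho in H0; nra).
  assert (Exi : 2 * xi = r ^ 4 * rho).
  { rewrite <- (Cmod_polar (2 * xi) 0), cis_0, Cmult_1_r, <- Eqy by lra.
    now rewrite Cmod_mult, Cmod_pow, Hmy. }
  assert (Hrho : 1 + sqrt 2 * r + r ^ 2 <= rho ^ 2 <= (1 + r) ^ 2) by nra.
  pose proof (ninth_root_bounds r rho p Hr Hp0 (Rpower_2_9_pow9 xi r rho p Hxi Exi eq_refl) Hrho)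
    as [Hrp Hpr].
  assert (Hpa : p <= r + gap_bound r).
  { unfold gap_bound; pose proof (pow2_ge_0 (1 - r)); simpl in *; lra. }
  set (X := Cmod (y - RtoC p)%C).
  assert (HX : X ^ 2 <= dist_sq_bound r).
  { unfold X; rewrite Ey; apply (dist_to_positive_sqr r s p); lra. }
  assert (Hrhop : rho <= Cmod (u + RtoC p)%C).
  { assert (E : Cmod (u + RtoC p)%C ^ 2 = 1 + 2 * p * cos theta + p ^ 2).
    { replace (u + RtoC p)%C with (RtoC 1 * cis theta + RtoC p * cis 0)%C
        by (rewrite cis_0; unfold u; ring).
      rewrite Cmod_polar_add_sqr, Rminus_0_r; ring. }
    assert (cos (theta + s) <= cos theta) by (apply cos_decr_1; lra).
    pose proof (Cmod_ge_0 (u + RtoC p)%C).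
    assert (r * cos (theta + s) <= p * cos theta) by (apply Rmult_le_compat; lra).
    nra. }
  assert (Hy0 : y <> 0) by (intro E; rewrite E, Cmod_0 in Hmy; lra).
  set (h := (t / y)%C).
  assert (Eh : h = (RtoC (tau / r) * cis (s - beta))%C).
  { unfold h; rewrite Et, Ey, polar_div by exact Hr; f_equal; f_equal; ring. }
  assert (Hty : t = (h * y)%C) by (unfold h; field; exact Hy0).
  assert (Eh4 : (h ^ 4 * (u + RtoC p))%C = (u + y)%C).
  { apply (Cmult_cancel_r _ _ (y ^ 4)); [now apply Cpow_nz|].
    rewrite (Cmult_comm (u + y)), Eqy, <- Eqt, Hty; ring. }
  assert (Hx : 0 < tau / r) by (apply Rdiv_lt_0_compat; lra).
  destruct (root4_estimate (tau / r) (s - beta) rho X h (u + y) (u + RtoC p) Eh Hx)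
    as (Hx1 & Hxd & HeX).
  { apply Rabs_le; lra. }
  { exact Eh4. }
  { reflexivity. }
  { unfold X; f_equal; ring. }
  { lra. }
  set (e := Cmod (h - 1)%C) in *.
  assert (He : 0 <= e <= 1).
  { split; [apply Cmod_ge_0|].
    assert (E : e ^ 2 = (tau / r) ^ 2 + 2 * (tau / r) * (-1) * cos (s - beta) + (-1) ^ 2).
    { unfold e; rewrite Eh.
      replace (RtoC (tau / r) * cis (s - beta) - 1)%C
        with (RtoC (tau / r) * cis (s - beta) + RtoC (-1) * cis 0)%C.
      - rewrite Cmod_polar_add_sqr, Rminus_0_r; reflexivity.
      - replace (RtoC (-1)) with (- RtoC 1)%C by (rewrite <- RtoC_opp; f_equal; lra).
        rewrite cis_0; ring. }
    (* With [cos (s - beta) >= 1/2] and [tau / r <= 1], [e^2 <= x^2 - x + 1 <= 1] for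
       [x = tau / r]. *)
    pose proof (cos_ge_quadratic (s - beta)) as Hc.
    assert ((s - beta) ^ 2 <= 1) by nra.
    pose proof (Cmod_ge_0 (h - 1)%C) as He0; fold e in He0; nra. }
  destruct (polar_sum_sector r (1 / 5) (- s) theta) as (V & gam & HV & Hgam & Ew); try lra.
  set (w := (y + u / 5)%C).
  assert (Ew' : w = (RtoC V * cis gam)%C).
  { rewrite <- Ew; unfold w, u; rewrite Ey, RtoC_div by lra; unfold Cdiv; ring. }
  assert (HmV : Cmod w = V) by (rewrite Ew'; apply Cmod_polar; lra).
  assert (HV2 : root_sq_bound r <= V ^ 2).
  { rewrite <- (Cmod_polar V gam), <- Ew, Cmod_polar_add_sqr by lra.
    replace (- s - theta) with (- (theta + s)) by ring; rewrite cos_neg.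
    unfold root_sq_bound; nra. }
  destruct (scalar_error_bound r (tau / r) X rho e V) as [H4 H5]; try assumption.
  { apply Cmod_ge_0. }
  { unfold shift_sq_bound; nra. }
  set (Z := quintic_rhs xi u t).
  destruct (nth_root_spec 5 Z ltac:(lia)) as (E5 & x1 & psi & Hx1' & Hpsi & Ew1).
  set (w1 := nth_root 5 Z) in *.
  replace (INR 5) with 5 in Hpsi by (simpl; ring).
  (* This selects the right branch: with [gam] in [[-PI/20, PI/5]], the quotient [g] has its
     argument within [PI/4] of zero. *)
  assert (Hpsi0 : 0 <= psi).
  { apply (polar_upper_arg5_nonneg x1 psi Hx1' Hpsi); rewrite <- Ew1, E5.
    unfold Z; rewrite Et; now apply quintic_rhs_upper. }
  assert (Hw0 : w <> 0) by (intro E; rewrite E, Cmod_0 in HmV; lra).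
  set (g := (w1 / w)%C).
  assert (Eg : g = (RtoC (x1 / V) * cis (psi - gam))%C).
  { unfold g; rewrite Ew1, Ew'; now apply polar_div. }
  assert (ED : ((g ^ 5 - 1) * w ^ 5)%C = (Z - quintic_rhs xi u y)%C).
  { rewrite (quintic_rhs_root xi u y Eqy), <- E5; fold w.
    unfold g; field; exact Hw0. }
  assert (HD : Cmod (g ^ 5 - 1)%C * V ^ 5 <= lip_bound r * r * e).
  { rewrite <- HmV, <- Cmod_pow, <- Cmod_mult, ED.
    eapply Rle_trans.
    - apply (quintic_rhs_lipschitz xi r); [exact Hu| |lra].
      rewrite Hmt; apply Rle_div_l in Hx1; lra.
    - apply Req_le; fold (lip_bound r).
      replace (t - y)%C with ((h - 1) * y)%C by (rewrite Hty; ring).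
      rewrite Cmod_mult, Hmy; fold e; ring. }
  assert (HV5 : 0 < V ^ 5) by now apply pow_lt.
  assert (Hg : Cmod (g ^ 5 - 1)%C <= 3 / 100) by nra.
  assert (Hst : 486 / 100 * Cmod (g - 1)%C <= Cmod (g ^ 5 - 1)%C).
  { rewrite Eg in *; apply root5_stable.
    - apply Rdiv_le_0_compat; lra.
    - apply Rabs_le; lra.
    - exact Hg. }
  replace (y1 xi theta - y)%C with ((g - 1) * w)%C.
  2:{ unfold y1; fold u t; change (nth_root 5 _) with w1.
      transitivity (w1 - w)%C; [unfold g; field; exact Hw0|unfold w; ring]. }
  rewrite Cmod_mult, HmV.
  assert (HV4 : 0 < V ^ 4) by now apply pow_lt.
  assert (Hfin : Cmod (g ^ 5 - 1)%C * V <= 209 / 10000).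
  { apply (Rmult_le_reg_r (V ^ 4)); [exact HV4|].
    replace (Cmod (g ^ 5 - 1)%C * V * V ^ 4) with (Cmod (g ^ 5 - 1)%C * V ^ 5) by ring; lra. }
  (* The quotient of [209/10000] by [486/100] is about [0.0043004]. *)
  pose proof (Rmult_le_compat_r V _ _ ltac:(lra) Hst); lra.
Qed.
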